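(* Let $k\ge 2$ and $r$ be integers with $1\le r\le k$, let $A_r=\{a_1,a_2,\ldots,a_r\}\subseteq\{0,1,\ldots,k-1\}$ be a set with exactly $r$ elements, and put $n=f_k(A_r)$. Then $n$ divides $k$, and $d=k/n$ is a positive integer that divides $r$; that is, $k=nd$ and $r=md$ for a positive integer $m$. Furthermore, $$|\mathcal{A}_n(r,k)|=\sum_{s\mid (n,m)}\binom{n/s}{m/s}\mu(s),$$ where the sum is taken over all positive divisors $s$ of the greatest common divisor $(n,m)$ of $n$ and $m$. In particular, $$|\mathcal{A}_k(r,k)|=\sum_{s\mid (k,r)}\binom{k/s}{r/s}\mu(s).$$
   Context: For a finite set $A$ of nonnegative integers and a positive integer $i$, let $\overline{A}(i)\subseteq\{0,1,\ldots,i-1\}$ be the set of residues modulo $i$ of the elements of $A$; two finite sets $A,B$ are called equal modulo $i$ if $\overline{A}(i)=\overline{B}(i)$. Write $A+t=\{a+t: a\in A\}$. For integers $1\le j\le i$, $\mathcal{A}(j,i)$ denotes the collection of all subsets of $\{0,1,\ldots,i-1\}$ with exactly $j$ elements. For $A\in\mathcal{A}(j,i)$, $f_i(A)$ denotes the smallest positive integer $l$ such that $A$ equals $A+l$ modulo $i$ (it exists and is at most $i$). For $1\le s\le i$, $\mathcal{A}_s(j,i)=\{A\in\mathcal{A}(j,i): f_i(A)=s\}$. $(x,y)$ denotes the greatest common divisor, $|\cdot|$ cardinality, and $\mu$ the Möbius function. *)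

(* Defs.v *)
From mathcomp Require Import all_boot all_order all_algebra.
From mathcomp Require Import finmap.

Set Implicit Arguments.
Unset Strict Implicit.
Unset Printing Implicit Defensive.

Import GRing.Theory.

Local Open Scope fset_scope.
Local Open Scope nat_scope.

Definition residues (i : nat) (A : {fset nat}) : {fset nat} :=
  [fset a %% i | a in A].

Definition eqmodset (i : nat) (A B : {fset nat}) : bool :=
  residues i A == residues i B.

Definition shift (A : {fset nat}) (t : nat) : {fset nat} :=
  [fset a + t | a in A].

Definition subsets (j i : nat) : {fset {fset nat}} :=
  [fset A in fpowerset [fset x in iota 0 i] | #|` A| == j].

(* The smallest positive l such that A equals A + l modulo i. For 0 < i the
   search can be confined to l = 1, ..., i since l = i always works; the lemma
   periodP below shows that the bounded search computes the true minimum. *)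
Definition period (i : nat) (A : {fset nat}) : nat :=
  (find (fun l => eqmodset i A (shift A l)) (iota 1 i)).+1.

Lemma eqmodset_shift_self (i : nat) (A : {fset nat}) :
  eqmodset i A (shift A i).
Proof.
apply/eqP/fsetP => x; apply/imfsetP/imfsetP => /= -[y yA ->].
  by exists (y + i); rewrite ?modnDr //; apply/imfsetP; exists y.
by case/imfsetP: yA => z /= zA ->; exists z; rewrite ?modnDr.
Qed.

Lemma periodP (i : nat) (A : {fset nat}) : 0 < i ->
  [/\ 0 < period i A <= i,
      eqmodset i A (shift A (period i A)) &
      forall l, 0 < l -> eqmodset i A (shift A l) -> period i A <= l].
Proof.
move=> i0; rewrite /period; set p := fun l => _.
have hp : has p (iota 1 i).
  apply/hasP; exists i; first by rewrite mem_iota i0 addnC addn1 ltnS leqnn.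
  exact: eqmodset_shift_self.
have lt_i : find p (iota 1 i) < i by rewrite -[X in _ < X](size_iota 1) -has_find.
split=> // [|l l0 pl].
  by have := nth_find 0 hp; rewrite nth_iota.
case: (leqP l i) => [le_li|lt_il]; last exact: leq_trans lt_i (ltnW lt_il).
rewrite leqNgt; apply/negP; case: l l0 pl le_li => // l _ pl le_li; rewrite ltnS.
by move=> /(before_find 0); rewrite nth_iota // add1n /p pl.
Qed.

Definition subsets_period (s j i : nat) : {fset {fset nat}} :=
  [fset A in subsets j i | period i A == s].

(* The Moebius function, only meant for n > 0 (at n = 0 it has the
   meaningless value 1); n > 0 is squarefree iff all its prime divisors have
   valuation 1. *)
Definition moebius (n : nat) : int :=
  if all (fun p => logn p n == 1) (primes n)
  then ((-1) ^+ size (primes n))%R else 0%R.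

(* Main.v *)
(* The map x |-> (x %% k \in A) is a periodic indicator function on nat whose
   least period is [period k A]; hence [period k A] divides k. Extending
   periodically from [0, n) to [0, nd) preserves this function and multiplies
   the cardinality by d, so subsets of [0, nd) of size md and period n
   correspond to subsets of [0, n) of size m and period n. Sorting all
   r-subsets of [0, k) by d = k / period gives
     C(k, r) = sum_{d | (k, r)} N(k / d, r / d),
   N(n, m) being the number of m-subsets of [0, n) of period n, and Moebius
   inversion yields N. *)
Require Import Defs.
From mathcomp Require Import all_boot all_order all_algebra.
From mathcomp Require Import finmap.

Set Implicit Arguments.
Unset Strict Implicit.
Unset Printing Implicit Defensive.

Import GRing.Theory.

(** * Translation invariance modulo [i] and the least period *)

Lemma subsetsP j i (A : {fset nat}) :
  reflect ({in A, forall x, x < i} /\ #|` A| = j) (A \in subsets j i).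
Proof.
rewrite !inE /= fpowersetE.
apply: (iffP andP) => -[hA /eqP cA]; split=> //.
  by move=> x /(fsubsetP hA); rewrite !inE mem_iota.
by apply/fsubsetP => x /hA; rewrite !inE mem_iota.
Qed.

(** Equality of residue sets becomes invariance of the periodic indicator under translation by [l].
    Quantifying over all naturals [x] lets this be iterated with no case split on wrap-around. *)
Lemma eqmodset_shiftP i l (A : {fset nat}) : 0 < i -> {in A, forall x, x < i} ->
  reflect (forall x, ((x + l) %% i \in A) = (x %% i \in A))
          (eqmodset i A (shift A l)).
Proof.
move=> i0 hA.
have resA : residues i A = A.
  apply/fsetP => x; apply/imfsetP/idP => /= [[y yA ->]|xA].
    by rewrite modn_small ?hA.
  by exists x; rewrite ?modn_small ?hA.
have mem_resS x :
    reflect (exists2 a, a \in A & x = (a + l) %% i) (x \in residues i (shift A l)).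
  apply: (iffP idP) => [/imfsetP[_ /imfsetP[a aA ->] ->]|[a aA ->]].
    by exists a.
  by apply/imfsetP; exists (a + l) => //; apply/imfsetP; exists a.
rewrite /eqmodset resA; apply: (iffP eqP) => [eqA x | inv].
  apply/idP/idP => [|xA]; last by rewrite eqA; apply/mem_resS; exists (x %% i); rewrite ?modnDml.
  rewrite {1}eqA => /mem_resS [a aA] /eqP; rewrite eqn_modDr => /eqP ->.
  by rewrite modn_small ?hA.
apply/fsetP => x; apply/idP/mem_resS => [xA | [a aA ->]]; last first.
  by rewrite inv modn_small ?hA.
(* Since [l * i.-1] is congruent to [- l] modulo [i], this is the preimage of [x] under translation,
   written without truncated subtraction. *)
have shiftK : (((x + l * i.-1) %% i) + l) %% i = x.
  rewrite modnDml -addnA -mulnSr prednK // addnC modnMDl modn_small ?hA //.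
exists ((x + l * i.-1) %% i); last by [].
by rewrite -inv -modnDml shiftK.
Qed.

(** Multiples of a valid shift are valid, and so is the remainder of a valid shift modulo the least
    one; a nonzero remainder would contradict minimality. *)
Lemma eqmodset_shift_dvdn i l (A : {fset nat}) : 0 < i ->
    {in A, forall x, x < i} ->
  eqmodset i A (shift A l) = (period i A %| l).
Proof.
move=> i0 hA; have [/andP[n0 _] invn minn] := periodP A i0.
move/(eqmodset_shiftP _ i0 hA): invn minn; set n := period i A => invn minn.
have invM q x : ((x + q * n) %% i \in A) = (x %% i \in A).
  by elim: q => [|q IH]; rewrite ?addn0 // mulSn addnCA addnC invn.
apply/idP/idP => [/(eqmodset_shiftP _ i0 hA) invl | /dvdnP[q ->]]; last first.
  exact/(eqmodset_shiftP _ i0 hA).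
rewrite /dvdn; case: posnP => // lt0; have := ltn_pmod l n0.
rewrite ltnNge minn //; apply/(eqmodset_shiftP _ i0 hA) => x.
by rewrite -(invM (l %/ n)) -addnA [_ %% _ + _]addnC -divn_eq invl.
Qed.

Lemma period_dvdn i (A : {fset nat}) : 0 < i -> {in A, forall x, x < i} ->
  period i A %| i.
Proof. by move=> i0 hA; rewrite -eqmodset_shift_dvdn ?eqmodset_shift_self. Qed.

(** The multiples of the period are the valid shifts, which depend only on the indicator function on
    [nat] and not on the modulus used to represent it. *)
Lemma eq_period i j (A B : {fset nat}) : 0 < i -> 0 < j ->
    {in A, forall x, x < i} -> {in B, forall x, x < j} ->
    (forall x, (x %% i \in A) = (x %% j \in B)) ->
  period i A = period j B.
Proof.
move=> i0 j0 hA hB eqAB.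
have dvd l : (period i A %| l) = (period j B %| l).
  rewrite -!eqmodset_shift_dvdn //.
  by apply/eqmodset_shiftP/eqmodset_shiftP => // inv x; have := inv x; rewrite !eqAB.
by apply/eqP; rewrite eqn_dvd dvd -(dvd (period i A)) !dvdnn.
Qed.

(** * Periodic extension from [[0, n)] to [[0, n * d)] *)

Definition extend (n k : nat) (B : {fset nat}) : {fset nat} :=
  [fset x in iota 0 k | x %% n \in B]%fset.

Lemma mem_extend n k B x : (x \in extend n k B) = (x < k) && (x %% n \in B).
Proof. by rewrite !inE mem_iota. Qed.

Lemma card_extend n d (B : {fset nat}) : {in B, forall x, x < n} ->
  #|` extend n (n * d) B| = #|` B| * d.
Proof.
move=> hB.
have cardE k (C : {fset nat}) : {in C, forall x, x < k} ->
    #|` C| = count (fun x => x \in C) (iota 0 k).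
  move=> hC; rewrite -size_filter; apply/perm_size/uniq_perm => //.
    by rewrite filter_uniq ?iota_uniq.
  move=> x; rewrite mem_filter mem_iota /=.
  by case xC: (x \in C) => //=; rewrite hC.
rewrite (cardE (n * d)); last by move=> x; rewrite mem_extend => /andP[].
rewrite (@eq_in_count _ _ (fun x => x %% n \in B)); last first.
  by move=> x; rewrite mem_iota mem_extend /= => ->.
elim: d => [|d IH]; first by rewrite !muln0.
rewrite !mulnSr iotaD count_cat IH add0n -{1}[n * d]addn0 iotaDl count_map; congr (_ + _).
rewrite (cardE n) //; apply: eq_in_count => x; rewrite mem_iota /= => xn.
by rewrite mulnC modnMDl modn_small.
Qed.

Lemma extend_modn n d (B : {fset nat}) x : 0 < n -> 0 < d ->
  (x %% (n * d) \in extend n (n * d) B) = (x %% n \in B).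
Proof.
by move=> n0 d0; rewrite mem_extend ltn_mod muln_gt0 n0 d0 modn_dvdm // dvdn_mulr.
Qed.

Lemma period_extend n d (B : {fset nat}) : 0 < n -> 0 < d ->
  {in B, forall x, x < n} -> period (n * d) (extend n (n * d) B) = period n B.
Proof.
move=> n0 d0 hB; apply: eq_period => //; first by rewrite muln_gt0 n0.
  by move=> x; rewrite mem_extend => /andP[].
by move=> x; rewrite extend_modn.
Qed.

(** Invariance under translation by [n] makes [A] determined by its part below [n]. This gives
    surjectivity of extension. *)
Lemma extend_restrict n d (A : {fset nat}) : 0 < n -> 0 < d ->
    {in A, forall x, x < n * d} -> period (n * d) A %| n ->
  extend n (n * d) [fset x in A | x < n]%fset = A.
Proof.
move=> n0 d0 hA; have k0 : 0 < n * d by rewrite muln_gt0 n0.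
rewrite -eqmodset_shift_dvdn // => /(eqmodset_shiftP _ k0 hA) inv.
have invM q x : ((q * n + x) %% (n * d) \in A) = (x %% (n * d) \in A).
  by elim: q => [|q IH] //; rewrite mulSn -addnA addnC inv.
apply/fsetP => x; rewrite mem_extend !inE /= ltn_mod n0 andbT.
have [xk|kx] /= := ltnP; last by apply/esym/negP => /hA; rewrite ltnNge kx.
rewrite -[in RHS](modn_small xk) {2}(divn_eq x n) invM.
by rewrite [in RHS]modn_small // (leq_trans (ltn_pmod _ n0)) // leq_pmulr.
Qed.

Lemma mem_subsets_period s j i A :
  (A \in subsets_period s j i) = (A \in subsets j i) && (period i A == s).
Proof. by rewrite !inE. Qed.

(** Extension is a bijection between the two families, with inverse the restriction to [[0, n)]. *)
Lemma card_subsets_period_mul n m d : 0 < n -> 0 < d ->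
  #|` subsets_period n (m * d) (n * d)| = #|` subsets_period n m n|.
Proof.
move=> n0 d0; have k0 : 0 < n * d by rewrite muln_gt0 n0.
have -> : subsets_period n (m * d) (n * d) =
    [fset extend n (n * d) B | B in subsets_period n m n]%fset.
  apply/fsetP => A; apply/idP/imfsetP => /=.
    rewrite mem_subsets_period => /andP[/subsetsP[hA cA] /eqP pA].
    have eA : extend n (n * d) [fset x in A | x < n]%fset = A.
      by rewrite extend_restrict // pA.
    have hB : {in [fset x in A | x < n]%fset, forall x, x < n}.
      by move=> x; rewrite !inE => /andP[].
    exists [fset x in A | x < n]%fset => //.
    rewrite mem_subsets_period -(period_extend n0 d0 hB) eA pA eqxx andbT; apply/subsetsP.
    by split=> //; apply/eqP; rewrite -(eqn_pmul2r d0) -cA -(card_extend d hB) eA.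
  case=> B; rewrite mem_subsets_period => /andP[/subsetsP[hB cB] /eqP pB] ->.
  rewrite mem_subsets_period period_extend // pB eqxx andbT; apply/subsetsP; split.
    by move=> x; rewrite mem_extend => /andP[].
  by rewrite card_extend // cB.
have ltn_subsets D : D \in subsets_period n m n -> {in D, forall x, x < n}.
  by rewrite mem_subsets_period => /andP[/subsetsP[]].
apply: card_in_imfset => B C /= /ltn_subsets hB /ltn_subsets hC eBC.
(* The right-hand side sees [D] only through its extension, whence injectivity. *)
have mem_lt (D : {fset nat}) : {in D, forall x, x < n} ->
    forall x, (x \in D) = (x < n) && (x %% (n * d) \in extend n (n * d) D).
  move=> hD x; rewrite extend_modn //.
  have [xn|nx] /= := ltnP; first by rewrite modn_small.
  by apply/negP => /hD; rewrite ltnNge nx.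
by apply/fsetP => x; rewrite (mem_lt B hB) (mem_lt C hC) eBC.
Qed.

(** [A] is the extension of its part in one period, so its cardinality is a multiple of the number
    of periods in [[0, k)]. *)
Lemma period_dvd_card k r (A : {fset nat}) : 0 < k -> A \in subsets r k ->
  k %/ period k A %| r.
Proof.
move=> k0 /subsetsP[hA <-]; have [/andP[n0 _] _ _] := periodP A k0.
have nk := period_dvdn k0 hA.
have ek : k = period k A * (k %/ period k A) by rewrite mulnC divnK.
have d0 : 0 < k %/ period k A by rewrite divn_gt0 // dvdn_leq.
have hB : {in [fset x in A | x < period k A]%fset, forall x, x < period k A}.
  by move=> x; rewrite !inE => /andP[].
have := card_extend (k %/ period k A) hB.
rewrite -ek => cE; have := @extend_restrict _ _ A n0 d0.
by rewrite -ek => /(_ hA (dvdnn _)) eA; rewrite eA in cE; rewrite cE dvdn_mull.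
Qed.

(** * Counting subsets by period *)

Lemma card_subsets r k : #|` subsets r k| = 'C(k, r).
Proof.
pose f (A : {set 'I_k}) := [fset val x | x in A]%fset.
have fE (A : {set 'I_k}) (x : 'I_k) : (val x \in f A) = (x \in A).
  by rewrite mem_imfset //; exact: val_inj.
have cf A : #|` f A| = #|A| by rewrite card_imfset ?cardE //; exact: val_inj.
have -> : subsets r k = [fset f A | A in [set A : {set 'I_k} | #|A| == r]]%fset.
  apply/fsetP => B; apply/subsetsP/imfsetP => /= [[hB cB]|[A]].
    have eB : B = f [set x : 'I_k | val x \in B].
      apply/fsetP => x; apply/idP/imfsetP => /= [xB|[y]]; last by rewrite inE => ? ->.
      by exists (Ordinal (hB _ xB)); rewrite ?inE.
    by exists [set x : 'I_k | val x \in B]; rewrite // inE -cf -eB cB.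
  rewrite inE -cf => /eqP cA ->; split=> // x /imfsetP[y _ ->]; exact: ltn_ord.
rewrite card_imfset /=; last first.
  by move=> A B eAB; apply/setP => x; rewrite -!fE eAB.
by rewrite -cardE card_draws card_ord.
Qed.

(** Double counting: each [A] is counted exactly once, at [d = k %/ period k A], which divides both
    [k] and [r]. *)
Lemma sum_card_subsets_period k r : 0 < k ->
  \sum_(d <- divisors (gcdn k r)) #|` subsets_period (k %/ d) r k| = 'C(k, r).
Proof.
move=> k0; rewrite -card_subsets card_fset_sum1.
have cardE s : #|` subsets_period s r k| =
    \sum_(A <- subsets r k) (period k A == s : nat).
  rewrite (eq_bigr (fun A => if period k A == s then 1 else 0)); last first.
    by move=> A _; case: eqP.
  rewrite -big_mkcond sum1_count -size_filter; apply/perm_size/uniq_perm.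
  - exact: fset_uniq.
  - by rewrite filter_uniq ?fset_uniq.
  by move=> A; rewrite mem_filter andbC -mem_subsets_period.
rewrite (eq_bigr _ (fun d _ => cardE (k %/ d))) exchange_big /=.
rewrite !big_seq; apply: eq_bigr => A Ark.
have [/andP[n0 _] _ _] := periodP A k0.
have nk : period k A %| k by apply: period_dvdn => //; have [] := subsetsP _ _ _ Ark.
have d0 : 0 < k %/ period k A by rewrite divn_gt0 // dvdn_leq.
have g0 : 0 < gcdn k r by rewrite gcdn_gt0 k0.
have dg : k %/ period k A \in divisors (gcdn k r).
  rewrite -dvdn_divisors // dvdn_gcd (period_dvd_card k0 Ark) andbT.
  by rewrite dvdn_div.
rewrite (bigD1_seq (k %/ period k A)) ?divisors_uniq //=.
rewrite divnA // mulKn // eqxx big1_seq ?addn0 // => d /andP[nd].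
rewrite -dvdn_divisors // dvdn_gcd => /andP[dk _].
case: eqP => // pE; case/eqP: nd; rewrite pE divnA // mulKn //.
Qed.

Lemma sum_card_aperiodic k r : 0 < k ->
  \sum_(d <- divisors (gcdn k r)) #|` subsets_period (k %/ d) (r %/ d) (k %/ d)|
    = 'C(k, r).
Proof.
move=> k0; rewrite -sum_card_subsets_period // !big_seq; apply: eq_bigr => d.
rewrite -dvdn_divisors ?gcdn_gt0 ?k0 // dvdn_gcd => /andP[dk dr].
have d0 : 0 < d by apply: dvdn_gt0 dk.
by rewrite -(@card_subsets_period_mul _ _ d) ?divn_gt0 ?(dvdn_leq k0) // !divnK.
Qed.

(** * The Moebius function and inversion over divisors *)

Local Open Scope ring_scope.

Lemma moebiusMprime p t : prime p -> (0 < t)%N ->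
  moebius (p * t) = if (p %| t)%N then 0 else - moebius t.
Proof.
move=> pp t0; have p0 := prime_gt0 pp; rewrite /moebius.
have lognE q : prime q -> logn q (p * t) = ((q == p) + logn q t)%N.
  by move=> pq; rewrite lognM // logn_prime.
case: (boolP (p %| t)%N) => [pt|npt].
  (* If [p] divides [t], the valuation of [p * t] at [p] is at least 2, so the squarefreeness test
     fails. *)
  case: ifP => // /allP/(_ p); rewrite mem_primes pp muln_gt0 p0 t0 dvdn_mulr //.
  by rewrite lognE // eqxx eqSS -[_ == _]negbK -lt0n logn_gt0 mem_primes pp t0 pt => /(_ isT).
have pprimes : perm_eq (primes (p * t)) (p :: primes t).
  apply: uniq_perm; rewrite ?primes_uniq //=.
    by rewrite primes_uniq mem_primes (negPf npt) !andbF.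
  by move=> q; rewrite primesM // primes_prime // !inE.
rewrite (perm_all _ pprimes) (perm_size pprimes) /= lognE // eqxx.
have -> : logn p t = 0%N by apply/eqP; rewrite -leqn0 leqNgt logn_gt0 mem_primes (negPf npt) !andbF.
rewrite /= (@eq_in_all _ _ (fun q => logn q t == 1%N)).
  by case: ifP => _; rewrite ?oppr0 // exprS mulN1r.
move=> q; rewrite mem_primes => /and3P[pq _ qt]; rewrite lognE //.
by rewrite (_ : q == p = false) //; apply: contraNF npt => /eqP <-.
Qed.

Lemma sum_divisors_dvdn (s g : nat) (F : nat -> int) : (0 < g)%N -> (s %| g)%N ->
  \sum_(e <- divisors g | (s %| e)%N) F e = \sum_(d <- divisors (g %/ s)) F (s * d)%N.
Proof.
move=> g0 sg; have s0 := dvdn_gt0 g0 sg.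
have gs0 : (0 < g %/ s)%N by rewrite divn_gt0 // dvdn_leq.
rewrite -big_filter -(big_map (muln s) xpredT F); apply: perm_big.
apply: uniq_perm.
- by rewrite filter_uniq ?divisors_uniq.
- by rewrite map_inj_uniq ?divisors_uniq // => x y /eqP; rewrite eqn_pmul2l // => /eqP.
move=> e; rewrite mem_filter -dvdn_divisors //; apply/andP/mapP.
  case=> /dvdnP[d ->] dg; exists d; last exact: mulnC.
  by rewrite -dvdn_divisors // -(dvdn_pmul2r s0) divnK.
case=> d; rewrite -dvdn_divisors // -(dvdn_pmul2l s0) [(s * (_ %/ _))%N]mulnC divnK // => dg ->.
by rewrite dvdn_mulr.
Qed.

(** For [e > 1] and [p] its least prime factor, divisors [p * d] contribute minus the Moebius values
    of those [d] dividing [e %/ p] that are prime to [p]. These [d] are exactly the divisors of [e]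
    prime to [p], so everything cancels. *)
Lemma sum_moebius_divisors e : (0 < e)%N ->
  \sum_(s <- divisors e) moebius s = (e == 1%N)%:R.
Proof.
move=> e0; have [-> | e1] := eqVneq e 1%N; first by rewrite big_seq1.
have pp : prime (pdiv e) by rewrite pdiv_prime // ltn_neqAle eq_sym e1.
set p := pdiv e in pp; have pe : (p %| e)%N := pdiv_dvd e.
have p0 := prime_gt0 pp.
have ep0 : (0 < e %/ p)%N by rewrite divn_gt0 // dvdn_leq.
rewrite (bigID (fun s => p %| s)%N) /= sum_divisors_dvdn //.
have -> : \sum_(d <- divisors (e %/ p)) moebius (p * d) =
    - \sum_(d <- divisors (e %/ p) | ~~ (p %| d)%N) moebius d.
  rewrite -sumrN [RHS]big_mkcond /= !big_seq; apply: eq_bigr => d.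
  rewrite -dvdn_divisors // => /(dvdn_gt0 ep0) d0.
  by rewrite moebiusMprime //; case: (p %| d)%N.
apply/eqP; rewrite addrC subr_eq0; apply/eqP.
rewrite -big_filter -[RHS]big_filter; apply: perm_big; apply: uniq_perm.
- by rewrite filter_uniq ?divisors_uniq.
- by rewrite filter_uniq ?divisors_uniq.
move=> d; rewrite !mem_filter -!dvdn_divisors //.
case: (boolP (p %| d)%N) => //= npd.
by rewrite -{1}(divnK pe) Gauss_dvdl // coprime_sym prime_coprime.
Qed.

(** After setting [e = s * d] and exchanging sums, the coefficient of [F e] is the Moebius sum over
    the divisors of [e], which vanishes unless [e = 1]. *)
Lemma moebius_inversion (g : nat) (F : nat -> int) : (0 < g)%N ->
  \sum_(s <- divisors g) (\sum_(d <- divisors (g %/ s)) F (s * d)%N) * moebius s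
    = F 1%N.
Proof.
move=> g0.
transitivity (\sum_(s <- divisors g) \sum_(e <- divisors g | (s %| e)%N)
    F e * moebius s).
  rewrite !big_seq; apply: eq_bigr => s; rewrite -dvdn_divisors // => sg.
  by rewrite -sum_divisors_dvdn // mulr_suml.
rewrite (exchange_big_dep xpredT) //=.
transitivity (\sum_(e <- divisors g) F e * (e == 1%N)%:R).
  rewrite !big_seq; apply: eq_bigr => e; rewrite -dvdn_divisors // => eg.
  have e0 := dvdn_gt0 g0 eg.
  rewrite -sum_moebius_divisors // mulr_sumr -big_filter; apply: perm_big.
  apply: uniq_perm; rewrite ?filter_uniq ?divisors_uniq //.
  move=> s; rewrite mem_filter -!dvdn_divisors //.
  by apply: andb_idr => /dvdn_trans; exact.
rewrite (bigD1_seq 1%N) ?divisors_uniq ?divisor1 //= mulr1.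
by rewrite big1 ?addr0 // => e /negPf ->; rewrite mulr0.
Qed.

Lemma card_aperiodic k r : (0 < k)%N ->
  Posz #|` subsets_period k r k| =
  \sum_(s <- divisors (gcdn k r)) Posz 'C(k %/ s, r %/ s) * moebius s.
Proof.
move=> k0; have g0 : (0 < gcdn k r)%N by rewrite gcdn_gt0 k0.
(* With this [F], the inner sum of the inversion formula at [s] is the binomial of [k %/ s] and
   [r %/ s], by [sum_card_aperiodic]. *)
pose F d := Posz #|` subsets_period (k %/ d) (r %/ d) (k %/ d)|.
have -> : Posz #|` subsets_period k r k| = F 1%N by rewrite /F !divn1.
rewrite -(moebius_inversion F g0) !big_seq; apply: eq_bigr => s.
rewrite -dvdn_divisors // => sg; congr (_ * _).
have := sg; rewrite dvdn_gcd => /andP[sk sr].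
have s0 := dvdn_gt0 k0 sk.
rewrite -sum_card_aperiodic ?divn_gt0 ?(dvdn_leq k0) //.
have -> : gcdn (k %/ s) (r %/ s) = (gcdn k r %/ s)%N.
  by rewrite -{2}(divnK sk) -{2}(divnK sr) -muln_gcdl mulnK.
rewrite (big_morph Posz PoszD (erefl _)); apply: eq_bigr => d _.
by rewrite /F !divnMA.
Qed.

Theorem theorem1 (k r : nat) (A : {fset nat})
  (hk : (2 <= k)%N) (hr : (1 <= r <= k)%N) (hA : A \in subsets r k) :
  let n := period k A in
  let d := (k %/ n)%N in
  [/\ (n %| k)%N, (0 < d)%N, (d %| r)%N,
      exists m : nat,
        [/\ (0 < m)%N, k = (n * d)%N, r = (m * d)%N &
            Posz #|` subsets_period n r k| =
            (\sum_(s <- divisors (gcdn n m))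
               Posz 'C(n %/ s, m %/ s) * moebius s)%R] &
      Posz #|` subsets_period k r k| =
      (\sum_(s <- divisors (gcdn k r))
         Posz 'C(k %/ s, r %/ s) * moebius s)%R].
Proof.
have k0 : (0 < k)%N by apply: ltnW.
have r0 : (0 < r)%N by case/andP: hr.
move=> n d; have [/andP[n0 _] _ _] := periodP A k0.
have nk : (n %| k)%N by apply: period_dvdn => //; have [] := subsetsP _ _ _ hA.
have d0 : (0 < d)%N by rewrite divn_gt0 // dvdn_leq.
have dr : (d %| r)%N := period_dvd_card k0 hA.
have kE : k = (n * d)%N by rewrite mulnC divnK.
have rE : r = (r %/ d * d)%N by rewrite divnK.
split=> //; last exact: card_aperiodic.
exists (r %/ d)%N; split=> //; first by rewrite divn_gt0 // dvdn_leq.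
(* Reduction from modulus [n * d] to modulus [n], where sets of period [n] have full period. *)
by rewrite {1}rE [X in subsets_period _ _ X]kE card_subsets_period_mul // card_aperiodic.
Qed.
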